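(* Let $\mathbb{F}$ be an algebraically closed field of characteristic $2$, and let $A_{1,2}(\alpha_1,\alpha_2,\alpha_4,\beta_1),\dots,A_{12,2}$ be the $2$-dimensional algebras over $\mathbb{F}$ given by the matrices of structure constants listed in the context. Then, for all values of the parameters $\alpha_1,\alpha_2,\alpha_4,\beta_1,\beta_2\in\mathbb{F}$ (subject to the restrictions indicated), the derivation algebras are: \begin{itemize} \item $Der(A_{1,2}(\alpha_1,\alpha_2,\alpha_4,\beta_1))=\{0\}$; \item $Der(A_{2,2}(\alpha_1,\beta_1,\beta_2))=\{0\}$ if $\beta_1\neq 0$, and $Der(A_{2,2}(\alpha_1,0,\beta_2))=\left\{\begin{pmatrix}0&0\\0&d\end{pmatrix}: d\in\mathbb{F}\right\}$; \item $Der(A_{3,2}(\alpha_1,\beta_2))=\{0\}$ if $\beta_2\neq 1$, and $Der(A_{3,2}(\alpha_1,1))=\left\{\begin{pmatrix}0&0\\c&0\end{pmatrix}: c\in\mathbb{F}\right\}$; \item $Der(A_{4,2}(\alpha_1,\beta_2))=\left\{\begin{pmatrix}0&0\\0&d\end{pmatrix}: d\in\mathbb{F}\right\}$ if $\beta_2\neq 1$; \item $Der(A_{4,2}(\alpha_1,-1))=\left\{\begin{pmatrix}0&0\\c&d\end{pmatrix}: c,d\in\mathbb{F}\right\}$ (where $-1=1$ in $\mathbb{F}$); \item $Der(A_{5,2}(\alpha_1))=\left\{\begin{pmatrix}0&0\\c&0\end{pmatrix}: c\in\mathbb{F}\right\}$; \item $Der(A_{6,2}(\alpha_1,\beta_1))=\{0\}$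 if $\beta_1\neq 0$, and $Der(A_{6,2}(\alpha_1,0))=\left\{\begin{pmatrix}0&0\\0&d\end{pmatrix}: d\in\mathbb{F}\right\}$; \item $Der(A_{7,2}(\alpha_1))=\{0\}$ if $\alpha_1\neq 1$, and $Der(A_{7,2}(1))=\left\{\begin{pmatrix}0&0\\c&0\end{pmatrix}: c\in\mathbb{F}\right\}$; \item $Der(A_{8,2}(\alpha_1))=\left\{\begin{pmatrix}0&0\\0&d\end{pmatrix}: d\in\mathbb{F}\right\}$ if $\alpha_1\neq 1$, and $Der(A_{8,2}(1))=\left\{\begin{pmatrix}0&0\\c&d\end{pmatrix}: c,d\in\mathbb{F}\right\}$; \item $Der(A_{9,2})=\left\{\begin{pmatrix}0&0\\c&0\end{pmatrix}: c\in\mathbb{F}\right\}$; \item $Der(A_{10,2})=\left\{\begin{pmatrix}a&0\\c&0\end{pmatrix}: a,c\in\mathbb{F}\right\}$; \item $Der(A_{11,2})=\{0\}$; \item $Der(A_{12,2})=\left\{\begin{pmatrix}a&0\\c&0\end{pmatrix}: a,c\in\mathbb{F}\right\}$. \end{itemize}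
   Context: An algebra over $\mathbb{F}$ is a vector space with a bilinear multiplication (no associativity, commutativity or unit is assumed). A $2$-dimensional algebra $\mathbb{A}$ with fixed basis $e=(e^1,e^2)$ is identified with its matrix of structure constants (MSC) $A=\begin{pmatrix}\alpha_1&\alpha_2&\alpha_3&\alpha_4\\ \beta_1&\beta_2&\beta_3&\beta_4\end{pmatrix}\in M(2\times 4;\mathbb{F})$, meaning $\mathbf{u}\cdot\mathbf{v}=eA(u\otimes v)$ for $\mathbf{u}=eu$, $\mathbf{v}=ev$ with coordinate column vectors $u,v$. Explicitly, $e^1e^1=\alpha_1e^1+\beta_1e^2$, $e^1e^2=\alpha_2e^1+\beta_2e^2$, $e^2e^1=\alpha_3e^1+\beta_3e^2$, $e^2e^2=\alpha_4e^1+\beta_4e^2$. A derivation is a linear map $\mathbf{d}$ with $\mathbf{d}(\mathbf{u}\cdot\mathbf{v})=\mathbf{d}(\mathbf{u})\cdot\mathbf{v}+\mathbf{u}\cdot\mathbf{d}(\mathbf{v})$; it is represented by the matrix $D\in M(2;\mathbb{F})$ with $\mathbf{d}(eu)=eDu$, so that $$Der(A)=\{D\in M(2;\mathbb{F}): A(D\otimes I+I\otimes D)-DA=0\},$$ where $I$ is the $2\times2$ identity matrix and, for matrices $X=(x_{ij})$ and $Y$, $X\otimes Y$ is the block matrix with blocks $(x_{ij}Y)$. The algebras are (all parameters are arbitrary elements of $\mathbb{F}$): $A_{1,2}(\alpha_1,\alpha_2,\alpha_4,\beta_1)=\begin{pmatrix}\alpha_1&\alpha_2&\alpha_2+1&\alpha_4\\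 \beta_1&-\alpha_1&-\alpha_1+1&-\alpha_2\end{pmatrix}$; $A_{2,2}(\alpha_1,\beta_1,\beta_2)=\begin{pmatrix}\alpha_1&0&0&1\\ \beta_1&\beta_2&1-\alpha_1&0\end{pmatrix}$; $A_{3,2}(\alpha_1,\beta_2)=\begin{pmatrix}\alpha_1&1&1&0\\ 0&\beta_2&1-\alpha_1&1\end{pmatrix}$; $A_{4,2}(\alpha_1,\beta_2)=\begin{pmatrix}\alpha_1&0&0&0\\ 0&\beta_2&1-\alpha_1&0\end{pmatrix}$; $A_{5,2}(\alpha_1)=\begin{pmatrix}\alpha_1&0&0&0\\ 1&1&1-\alpha_1&0\end{pmatrix}$; $A_{6,2}(\alpha_1,\beta_1)=\begin{pmatrix}\alpha_1&0&0&1\\ \beta_1&1-\alpha_1&-\alpha_1&0\end{pmatrix}$; $A_{7,2}(\alpha_1)=\begin{pmatrix}\alpha_1&1&1&0\\ 0&1-\alpha_1&-\alpha_1&-1\end{pmatrix}$; $A_{8,2}(\alpha_1)=\begin{pmatrix}\alpha_1&0&0&0\\ 0&1-\alpha_1&-\alpha_1&0\end{pmatrix}$; $A_{9,2}=\begin{pmatrix}1&0&0&0\\ 1&0&1&0\end{pmatrix}$; $A_{10,2}=\begin{pmatrix}0&1&1&0\\ 0&0&0&-1\end{pmatrix}$; $A_{11,2}=\begin{pmatrix}1&1&1&0\\ 0&-1&-1&-1\end{pmatrix}$; $A_{12,2}=\begin{pmatrix}0&0&0&0\\ 1&0&0&0\end{pmatrix}$. *)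

(* Defs.v *)
From mathcomp Require Import all_boot all_algebra.
From mathcomp Require Import boolp classical_sets.
From mathcomp.real_closed Require Import mxtens.

Set Implicit Arguments.
Unset Strict Implicit.
Unset Printing Implicit Defensive.

Import GRing.Theory.
Local Open Scope classical_set_scope.
Local Open Scope ring_scope.

Definition mx22 (F : fieldType) (a b c d : F) : 'M[F]_2 :=
  \matrix_(i, j) (nth [::] [:: [:: a; b]; [:: c; d]] i)`_j.

(* The width is written 2 * 2 so that these matrices can be multiplied with
   Kronecker products [*t]; its columns are ordered
   e^1 e^1, e^1 e^2, e^2 e^1, e^2 e^2. *)
Definition msc (F : fieldType) (a1 a2 a3 a4 b1 b2 b3 b4 : F) :
    'M[F]_(2, 2 * 2) :=
  \matrix_(i, j) (nth [::] [:: [:: a1; a2; a3; a4]; [:: b1; b2; b3; b4]] i)`_j.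

Definition amul (F : fieldType) (A : 'M[F]_(2, 2 * 2)) (u v : 'cV[F]_2) :
    'cV[F]_2 :=
  A *m (u *t v).

Definition Der (F : fieldType) (A : 'M[F]_(2, 2 * 2)) : set 'M[F]_2 :=
  [set D | A *m (D *t 1%:M + 1%:M *t D) - D *m A = 0].

Lemma tensmx_col_delta (F : fieldType) (j k : 'I_2) :
  (delta_mx j ord0 : 'cV[F]_2) *t (delta_mx k ord0 : 'cV[F]_2) =
  delta_mx (mxtens_index (j, k)) ord0.
Proof.
apply/matrixP => i l; rewrite !mxE !ord1 /= !andbT -natrM mulnb.
by rewrite -(can_eq (@mxtens_unindexK 2 2)) mxtens_indexK.
Qed.

Lemma DerP (F : fieldType) (A : 'M[F]_(2, 2 * 2)) (D : 'M[F]_2) :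
  Der A D <->
  forall u v : 'cV[F]_2,
    D *m amul A u v = amul A (D *m u) v + amul A u (D *m v).
Proof.
have tensE (u v : 'cV[F]_2) : amul A (D *m u) v + amul A u (D *m v) =
    A *m (D *t 1%:M + 1%:M *t D) *m (u *t v).
  rewrite /amul -{1}[v]mul1mx -{2}[u]mul1mx.
  by rewrite -!tensmx_mul -mulmxDr -mulmxDl mulmxA.
split=> [/subr0_eq AD u v | AD]; first by rewrite tensE AD /amul mulmxA.
apply/eqP; rewrite subr_eq0; apply/eqP/matrixP => i k.
have [j l] := mxtens_indexP k.
have /(congr1 (fun M : 'cV_2 => M i ord0)) :=
  AD (delta_mx j ord0) (delta_mx l ord0).
by rewrite tensE /amul mulmxA tensmx_col_delta -!colE !mxE.
Qed.

Lemma amul_msc (F : fieldType) (a1 a2 a3 a4 b1 b2 b3 b4 : F) :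
  let A := msc a1 a2 a3 a4 b1 b2 b3 b4 in
  let e (i : 'I_2) : 'cV[F]_2 := delta_mx i ord0 in
  let e1 := e ord0 in let e2 := e ord_max in
  [/\ amul A e1 e1 = a1 *: e1 + b1 *: e2, amul A e1 e2 = a2 *: e1 + b2 *: e2,
      amul A e2 e1 = a3 *: e1 + b3 *: e2 & amul A e2 e2 = a4 *: e1 + b4 *: e2].
Proof.
by split; rewrite /amul tensmx_col_delta -colE; apply/matrixP => i j;
  rewrite !mxE !ord1; case: i => [[|[|//]] hi] /=;
  rewrite ?mulr1 ?mulr0 ?addr0 ?add0r.
Qed.

Definition A1_2 (F : fieldType) (a1 a2 a4 b1 : F) : 'M[F]_(2, 2 * 2) :=
  msc a1 a2 (a2 + 1) a4
      b1 (- a1) (- a1 + 1) (- a2).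
Definition A2_2 (F : fieldType) (a1 b1 b2 : F) : 'M[F]_(2, 2 * 2) :=
  msc a1 0 0 1
      b1 b2 (1 - a1) 0.
Definition A3_2 (F : fieldType) (a1 b2 : F) : 'M[F]_(2, 2 * 2) :=
  msc a1 1 1 0
      0 b2 (1 - a1) 1.
Definition A4_2 (F : fieldType) (a1 b2 : F) : 'M[F]_(2, 2 * 2) :=
  msc a1 0 0 0
      0 b2 (1 - a1) 0.
Definition A5_2 (F : fieldType) (a1 : F) : 'M[F]_(2, 2 * 2) :=
  msc a1 0 0 0
      1 1 (1 - a1) 0.
Definition A6_2 (F : fieldType) (a1 b1 : F) : 'M[F]_(2, 2 * 2) :=
  msc a1 0 0 1
      b1 (1 - a1) (- a1) 0.
Definition A7_2 (F : fieldType) (a1 : F) : 'M[F]_(2, 2 * 2) :=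
  msc a1 1 1 0
      0 (1 - a1) (- a1) (- 1).
Definition A8_2 (F : fieldType) (a1 : F) : 'M[F]_(2, 2 * 2) :=
  msc a1 0 0 0
      0 (1 - a1) (- a1) 0.
Definition A9_2 (F : fieldType) : 'M[F]_(2, 2 * 2) :=
  msc 1 0 0 0
      1 0 1 0.
Definition A10_2 (F : fieldType) : 'M[F]_(2, 2 * 2) :=
  msc 0 1 1 0
      0 0 0 (- 1).
Definition A11_2 (F : fieldType) : 'M[F]_(2, 2 * 2) :=
  msc 1 1 1 0
      0 (- 1) (- 1) (- 1).
Definition A12_2 (F : fieldType) : 'M[F]_(2, 2 * 2) :=
  msc 0 0 0 0
      1 0 0 0.

Arguments A9_2 : clear implicits.
Arguments A10_2 : clear implicits.
Arguments A11_2 : clear implicits.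
Arguments A12_2 : clear implicits.

(* Main.v *)
Require Import Defs.
From mathcomp Require Import all_boot all_algebra ring.
From mathcomp Require Import boolp classical_sets.
From mathcomp.real_closed Require Import mxtens.

Import GRing.Theory.
Local Open Scope classical_set_scope.
Local Open Scope ring_scope.

(** Write [D = mx22 a b c d].  Since the Leibniz rule is bilinear, [D] is a
    derivation exactly when the rule holds on the four products of basis
    vectors; comparing coordinates gives eight equations, linear in
    [a], [b], [c], [d], whose coefficients are structure constants
    ([Der_mscP]).  For each of the twelve families the system is solved by
    elimination over a field of characteristic 2 ([Der_A1P] to [Der_A12P]).

    The elimination never divides by a parameter: equations are added, which in
    characteristic 2 is the same as subtracting them, in such a way that the
    parameters cancel and the remaining unknown has coefficient 1.
    For instance [a1 * a = 0] and [(1 - a1) * a = 0] give [a = 0] for every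
    value of [a1].  What can survive is a single equation with a parameter:
    [b1 * d = 0] for the second and sixth families, [c * (b2 + 1) = 0] or
    [c * (a1 + 1) = 0] for the third, fourth, seventh and eighth.  These are
    the case distinctions of the theorem: the equation forces an entry to
    vanish unless the parameter is [0], respectively [-1 = 1]. *)

(** * Matrices of size two by two *)

Lemma mx22_eta (F : fieldType) (D : 'M[F]_2) :
  D = mx22 (D 0 0) (D 0 1) (D 1 0) (D 1 1).
Proof.
apply/matrixP => i j; rewrite mxE.
by case: i j => [[|[|//]] ?] [[|[|//]] ?] /=; congr (D _ _); apply/val_inj.
Qed.

Lemma mx22_inj (F : fieldType) (a b c d a' b' c' d' : F) :
  mx22 a b c d = mx22 a' b' c' d' <-> [/\ a = a', b = b', c = c' & d = d'].
Proof.
split=> [/matrixP E | [-> -> -> ->] //].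
by have := (E 0 0, E 0 1, E 1 0, E 1 1); rewrite !mxE /= => -[[[]]].
Qed.

Lemma mx22_0 (F : fieldType) : mx22 0 0 0 0 = 0 :> 'M[F]_2.
Proof. by rewrite [RHS]mx22_eta !mxE. Qed.

Lemma eq_set_mx22 (F : fieldType) (S T : set 'M[F]_2) :
  (forall a b c d, S (mx22 a b c d) <-> T (mx22 a b c d)) -> S = T.
Proof.
by move=> ST; apply/seteqP; split=> D; rewrite [D]mx22_eta; move/ST.
Qed.

(** * Derivations in coordinates *)

(** An equation follows from a combination [l = r] of hypotheses by an
    identity that holds in the polynomial ring, which a ring decision procedure
    can check; [congr2 +%R] adds two hypotheses. *)
Lemma lincomb {R : pzRingType} {x y l r : R} : l = r -> x - y = l - r -> x = y.
Proof. by move=> -> /eqP; rewrite subrr subr_eq0 => /eqP. Qed.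

(** The pair of equations for [e^j e^k] lists the coordinates of the Leibniz
    rule along [e^1] and [e^2]; the pairs come in the order 11, 12, 21, 22.
    Terms that occur on both sides, such as [a2 * a] in the rule for
    [e^1 e^2], are already cancelled, which keeps the systems below small. *)
Lemma Der_mscP (F : fieldType) (a1 a2 a3 a4 b1 b2 b3 b4 a b c d : F) :
  Der (msc a1 a2 a3 a4 b1 b2 b3 b4) (mx22 a b c d) <->
  [/\ b1 * b = a1 * a + (a2 + a3) * c /\
      a1 * c + b1 * d = 2 * b1 * a + (b2 + b3) * c,
      b2 * b = a2 * d + a4 * c + a1 * b /\ a2 * c = b2 * a + b4 * c + b1 * b,
      b3 * b = a3 * d + a4 * c + a1 * b /\ a3 * c = b3 * a + b4 * c + b1 * b
    & a4 * a + b4 * b = (a2 + a3) * b + 2 * a4 * d /\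
      a4 * c = (b2 + b3) * b + b4 * d].
Proof.
set A := msc _ _ _ _ _ _ _ _; set D := mx22 a b c d.
have entryE : Der A D <->
    forall i k, (A *m (D *t 1%:M + 1%:M *t D)) i k = (D *m A) i k.
  split=> [/subr0_eq -> // | E].
  by rewrite /Der /=; apply/eqP; rewrite subr_eq0; apply/eqP/matrixP.
rewrite entryE; split=> [E | [[E11 F11] [E12 F12] [E21 F21] [E22 F22]] i k].
  have := (E 0 (Ordinal (isT : 0 < 2 * 2)%N), E 1 (Ordinal (isT : 0 < 2 * 2)%N),
    E 0 (Ordinal (isT : 1 < 2 * 2)%N), E 1 (Ordinal (isT : 1 < 2 * 2)%N),
    E 0 (Ordinal (isT : 2 < 2 * 2)%N), E 1 (Ordinal (isT : 2 < 2 * 2)%N),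
    E 0 (Ordinal (isT : 3 < 2 * 2)%N), E 1 (Ordinal (isT : 3 < 2 * 2)%N)).
  rewrite !mxE !big_ord_recl !big_ord0 !mxE /=.
  move=> [[[[[[[E11 F11] E12] F12] E21] F21] E22] F22].
  split; split.
  - by apply: (lincomb (esym E11)); ring.
  - by apply: (lincomb (esym F11)); ring.
  - by apply: (lincomb (esym E12)); ring.
  - by apply: (lincomb (esym F12)); ring.
  - by apply: (lincomb (esym E21)); ring.
  - by apply: (lincomb (esym F21)); ring.
  - by apply: (lincomb (esym E22)); ring.
  - by apply: (lincomb (esym F22)); ring.
rewrite !mxE !big_ord_recl !big_ord0 !mxE.
case: i k => [[|[|//]] ?] [[|[|[|[|//]]]] ?] /=.
- by apply: (lincomb (esym E11)); ring.
- by apply: (lincomb (esym E12)); ring.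
- by apply: (lincomb (esym E21)); ring.
- by apply: (lincomb (esym E22)); ring.
- by apply: (lincomb (esym F11)); ring.
- by apply: (lincomb (esym F12)); ring.
- by apply: (lincomb (esym F21)); ring.
- by apply: (lincomb (esym F22)); ring.
Qed.

(** * Elimination in characteristic two *)

(** These equalities reduce the integer coefficients from -4 to 4 modulo 2, the
    range produced when two equations of [Der_mscP] are combined.  The [ring]
    tactic rewrites a coefficient only when it is literally the left-hand side
    of a given equation, so [2 = 0] alone would not dispose of [-2] or [4]. *)
Lemma pchar2_numerals {F : fieldType} : 2%N \in [pchar F] ->
  [/\ -1 = 1 :> F, 2 = 0 :> F /\ -2 = 0 :> F, 3 = 1 :> F /\ -3 = 1 :> F
    & 4 = 0 :> F /\ -4 = 0 :> F].
Proof.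
move=> ch; have two0 : 2 = 0 :> F := pcharf0 ch.
have three1 : 3 = 1 :> F by rewrite -[3]/(2 + 1)%:R natrD two0 add0r.
have four0 : 4 = 0 :> F by rewrite -[4]/(2 * 2)%:R natrM two0 mulr0.
by rewrite !(oppr_pchar2 ch).
Qed.

Ltac ring2 ch :=
  let m1 := fresh in let p2 := fresh in let m2 := fresh in
  let p3 := fresh in let m3 := fresh in let p4 := fresh in let m4 := fresh in
  have [m1 [p2 m2] [p3 m3] [p4 m4]] := pchar2_numerals ch;
  ring: m1 p2 m2 p3 m3 p4 m4.

(** * The twelve families *)

(** A derivation of a two-dimensional algebra multiplies the commutator
    [e^2 e^1 - e^1 e^2] by its trace.  Here the commutator is [e^1 + e^2], which
    gives [b = d] and [c = a]. *)
Lemma Der_A1P {F : fieldType} (ch : 2%N \in [pchar F])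
    (a1 a2 a4 b1 a b c d : F) :
  Der (A1_2 a1 a2 a4 b1) (mx22 a b c d) <-> [/\ a = 0, b = 0, c = 0 & d = 0].
Proof.
rewrite Der_mscP; split=> [[[E11 F11] [E12 F12] [E21 F21] [E22 F22]]|].
  have bd : b = d by apply: (lincomb (congr2 +%R E12 E21)); ring2 ch.
  have ca : c = a by apply: (lincomb (congr2 +%R F12 F21)); ring2 ch.
  subst d c.
  have b0 : b = 0 by apply: (lincomb (congr2 +%R E12 E22)); ring2 ch.
  subst b.
  have a0 : a = 0 by apply: (lincomb (congr2 +%R E11 F12)); ring2 ch.
  by split.
by case=> *; subst; split; split; ring2 ch.
Qed.

Lemma Der_A2P {F : fieldType} (ch : 2%N \in [pchar F])
    (a1 b1 b2 a b c d : F) :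
  Der (A2_2 a1 b1 b2) (mx22 a b c d) <-> [/\ a = 0, b = 0, c = 0 & b1 * d = 0].
Proof.
rewrite Der_mscP; split=> [[[E11 F11] [E12 F12] [E21 F21] [E22 F22]]|].
  have a0 : a = 0 by apply: (lincomb E22); ring2 ch.
  subst a.
  (* [E12] gives [c = b2 b + a1 b], [F22] gives [c = (b2 + 1 - a1) b];
     all that is left of their sum is [b = 0]. *)
  have b0 : b = 0 by apply: (lincomb (congr2 +%R E12 F22)); ring2 ch.
  subst b.
  have c0 : c = 0 by apply: (lincomb E12); ring2 ch.
  subst c.
  by split=> //; apply: (lincomb F11); ring2 ch.
case=> -> -> -> E; split; split; try by ring2 ch.
by apply: (lincomb E); ring2 ch.
Qed.

Lemma Der_A3P {F : fieldType} (ch : 2%N \in [pchar F])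
    (a1 b2 a b c d : F) :
  Der (A3_2 a1 b2) (mx22 a b c d) <->
  [/\ a = 0, b = 0, d = 0 & c * (b2 + 1) = 0].
Proof.
rewrite Der_mscP; split=> [[[E11 F11] [E12 F12] [E21 F21] [E22 F22]]|].
  have b0 : b = 0 by apply: (lincomb E22); ring2 ch.
  subst b.
  have d0 : d = 0 by apply: (lincomb E21); ring2 ch.
  subst d.
  have a0 : a = 0 by apply: (lincomb (congr2 +%R E11 F21)); ring2 ch.
  subst a.
  by split=> //; apply: (lincomb F11); ring2 ch.
case=> -> -> -> E; split; split; try by ring2 ch.
by apply: (lincomb E); ring2 ch.
Qed.

Lemma Der_A4P {F : fieldType} (ch : 2%N \in [pchar F])
    (a1 b2 a b c d : F) :
  Der (A4_2 a1 b2) (mx22 a b c d) <-> [/\ a = 0, b = 0 & c * (b2 + 1) = 0].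
Proof.
rewrite Der_mscP; split=> [[[E11 F11] [E12 F12] [E21 F21] [E22 F22]]|].
  have b0 : b = 0 by apply: (lincomb E21); ring2 ch.
  subst b.
  have a0 : a = 0 by apply: (lincomb (congr2 +%R E11 F21)); ring2 ch.
  subst a.
  by split=> //; apply: (lincomb F11); ring2 ch.
case=> -> -> E; split; split; try by ring2 ch.
by apply: (lincomb E); ring2 ch.
Qed.

Lemma Der_A5P {F : fieldType} (ch : 2%N \in [pchar F])
    (a1 a b c d : F) :
  Der (A5_2 a1) (mx22 a b c d) <-> [/\ a = 0, b = 0 & d = 0].
Proof.
rewrite Der_mscP; split=> [[[E11 F11] [E12 F12] [E21 F21] [E22 F22]]|].
  have b0 : b = 0 by apply: (lincomb E21); ring2 ch.
  subst b.
  have a0 : a = 0 by apply: (lincomb (congr2 +%R E11 F21)); ring2 ch.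
  subst a.
  have d0 : d = 0 by apply: (lincomb F11); ring2 ch.
  subst d.
  by split.
by case=> *; subst; split; split; ring2 ch.
Qed.

Lemma Der_A6P {F : fieldType} (ch : 2%N \in [pchar F])
    (a1 b1 a b c d : F) :
  Der (A6_2 a1 b1) (mx22 a b c d) <-> [/\ a = 0, b = 0, c = 0 & b1 * d = 0].
Proof.
rewrite Der_mscP; split=> [[[E11 F11] [E12 F12] [E21 F21] [E22 F22]]|].
  have a0 : a = 0 by apply: (lincomb E22); ring2 ch.
  subst a.
  have c0 : c = 0 by apply: (lincomb E21); ring2 ch.
  subst c.
  have b0 : b = 0 by apply: (lincomb E12); ring2 ch.
  subst b.
  by split=> //; apply: (lincomb F11); ring2 ch.
case=> -> -> -> E; split; split; try by ring2 ch.
by apply: (lincomb E); ring2 ch.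
Qed.

Lemma Der_A7P {F : fieldType} (ch : 2%N \in [pchar F])
    (a1 a b c d : F) :
  Der (A7_2 a1) (mx22 a b c d) <->
  [/\ a = 0, b = 0, d = 0 & c * (a1 + 1) = 0].
Proof.
rewrite Der_mscP; split=> [[[E11 F11] [E12 F12] [E21 F21] [E22 F22]]|].
  have b0 : b = 0 by apply: (lincomb E22); ring2 ch.
  subst b.
  have d0 : d = 0 by apply: (lincomb E12); ring2 ch.
  subst d.
  have a0 : a = 0 by apply: (lincomb (congr2 +%R E11 F12)); ring2 ch.
  subst a.
  by split=> //; apply: (lincomb F11); ring2 ch.
case=> -> -> -> E; split; split; try by ring2 ch.
by apply: (lincomb E); ring2 ch.
Qed.

Lemma Der_A8P {F : fieldType} (ch : 2%N \in [pchar F])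
    (a1 a b c d : F) :
  Der (A8_2 a1) (mx22 a b c d) <-> [/\ a = 0, b = 0 & c * (a1 + 1) = 0].
Proof.
rewrite Der_mscP; split=> [[[E11 F11] [E12 F12] [E21 F21] [E22 F22]]|].
  have b0 : b = 0 by apply: (lincomb E12); ring2 ch.
  subst b.
  have a0 : a = 0 by apply: (lincomb (congr2 +%R E11 F12)); ring2 ch.
  subst a.
  by split=> //; apply: (lincomb F11); ring2 ch.
case=> -> -> E; split; split; try by ring2 ch.
by apply: (lincomb E); ring2 ch.
Qed.

Lemma Der_A9P {F : fieldType} (ch : 2%N \in [pchar F]) (a b c d : F) :
  Der (A9_2 F) (mx22 a b c d) <-> [/\ a = 0, b = 0 & d = 0].
Proof.
rewrite Der_mscP; split=> [[[E11 F11] [E12 F12] [E21 F21] [E22 F22]]|].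
  have b0 : b = 0 by apply: (lincomb E12); ring2 ch.
  subst b.
  have a0 : a = 0 by apply: (lincomb E11); ring2 ch.
  subst a.
  have d0 : d = 0 by apply: (lincomb F11); ring2 ch.
  subst d.
  by split.
by case=> *; subst; split; split; ring2 ch.
Qed.

Lemma Der_A10P {F : fieldType} (ch : 2%N \in [pchar F]) (a b c d : F) :
  Der (A10_2 F) (mx22 a b c d) <-> b = 0 /\ d = 0.
Proof.
rewrite Der_mscP; split=> [[[E11 F11] [E12 F12] [E21 F21] [E22 F22]]|].
  have b0 : b = 0 by apply: (lincomb E22); ring2 ch.
  subst b.
  have d0 : d = 0 by apply: (lincomb E12); ring2 ch.
  subst d.
  by split.
by case=> *; subst; split; split; ring2 ch.
Qed.

Lemma Der_A11P {F : fieldType} (ch : 2%N \in [pchar F]) (a b c d : F) :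
  Der (A11_2 F) (mx22 a b c d) <-> [/\ a = 0, b = 0, c = 0 & d = 0].
Proof.
rewrite Der_mscP; split=> [[[E11 F11] [E12 F12] [E21 F21] [E22 F22]]|].
  have b0 : b = 0 by apply: (lincomb E22); ring2 ch.
  subst b.
  have d0 : d = 0 by apply: (lincomb E12); ring2 ch.
  subst d.
  have a0 : a = 0 by apply: (lincomb E11); ring2 ch.
  subst a.
  have c0 : c = 0 by apply: (lincomb F11); ring2 ch.
  subst c.
  by split.
by case=> *; subst; split; split; ring2 ch.
Qed.

Lemma Der_A12P {F : fieldType} (ch : 2%N \in [pchar F]) (a b c d : F) :
  Der (A12_2 F) (mx22 a b c d) <-> b = 0 /\ d = 0.
Proof.
rewrite Der_mscP; split=> [[[E11 F11] [E12 F12] [E21 F21] [E22 F22]]|].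
  have b0 : b = 0 by apply: (lincomb E11); ring2 ch.
  subst b.
  have d0 : d = 0 by apply: (lincomb F11); ring2 ch.
  subst d.
  by split.
by case=> *; subst; split; split; ring2 ch.
Qed.

(** * The linear spaces of solutions *)

Lemma zero_mx22P {F : fieldType} (a b c d : F) :
  mx22 a b c d = 0 <-> [/\ a = 0, b = 0, c = 0 & d = 0].
Proof. by rewrite -(mx22_0 F) mx22_inj. Qed.

Lemma d_mx22P {F : fieldType} (a b c d : F) :
  (exists d', mx22 a b c d = mx22 0 0 0 d') <-> [/\ a = 0, b = 0 & c = 0].
Proof.
by split=> [[d' /mx22_inj[]] | [-> -> ->]]; last exists d.
Qed.

Lemma c_mx22P {F : fieldType} (a b c d : F) :
  (exists c', mx22 a b c d = mx22 0 0 c' 0) <-> [/\ a = 0, b = 0 & d = 0].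
Proof.
by split=> [[c' /mx22_inj[]] | [-> -> ->]]; last exists c.
Qed.

Lemma cd_mx22P {F : fieldType} (a b c d : F) :
  (exists c' d', mx22 a b c d = mx22 0 0 c' d') <-> a = 0 /\ b = 0.
Proof.
by split=> [[c' [d' /mx22_inj[]]] | [-> ->]]; last exists c, d.
Qed.

Lemma ac_mx22P {F : fieldType} (a b c d : F) :
  (exists a' c', mx22 a b c d = mx22 a' 0 c' 0) <-> b = 0 /\ d = 0.
Proof.
by split=> [[a' [c' /mx22_inj[]]] | [-> ->]]; last exists a, c.
Qed.

Lemma mulf_eq0_neq {F : fieldType} {x y : F} : x <> 0 -> x * y = 0 -> y = 0.
Proof. by move=> /eqP x0 /eqP; rewrite mulf_eq0 (negPf x0) => /eqP. Qed.

Lemma mulf_add1_eq0 {F : fieldType} (ch : 2%N \in [pchar F]) {x y : F} :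
  x <> 1 -> y * (x + 1) = 0 -> y = 0.
Proof.
move=> x1; rewrite mulrC; apply: mulf_eq0_neq => /eqP.
by rewrite addr_eq0 (oppr_pchar2 ch) => /eqP.
Qed.

Theorem theorem4p2 (F : closedFieldType) (char2 : 2%N \in [pchar F]) :
  (forall a1 a2 a4 b1 : F, Der (A1_2 a1 a2 a4 b1) = [set 0]) /\
  (forall a1 b1 b2 : F, b1 <> 0 -> Der (A2_2 a1 b1 b2) = [set 0]) /\
  (forall a1 b2 : F,
     Der (A2_2 a1 0 b2) = [set D | exists d : F, D = mx22 0 0 0 d]) /\
  (forall a1 b2 : F, b2 <> 1 -> Der (A3_2 a1 b2) = [set 0]) /\
  (forall a1 : F,
     Der (A3_2 a1 1) = [set D | exists c : F, D = mx22 0 0 c 0]) /\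
  (forall a1 b2 : F, b2 <> 1 ->
     Der (A4_2 a1 b2) = [set D | exists d : F, D = mx22 0 0 0 d]) /\
  (forall a1 : F,
     Der (A4_2 a1 (- 1)) = [set D | exists c d : F, D = mx22 0 0 c d]) /\
  (forall a1 : F,
     Der (A5_2 a1) = [set D | exists c : F, D = mx22 0 0 c 0]) /\
  (forall a1 b1 : F, b1 <> 0 -> Der (A6_2 a1 b1) = [set 0]) /\
  (forall a1 : F,
     Der (A6_2 a1 0) = [set D | exists d : F, D = mx22 0 0 0 d]) /\
  (forall a1 : F, a1 <> 1 -> Der (A7_2 a1) = [set 0]) /\
  (Der (A7_2 (1 : F)) = [set D | exists c : F, D = mx22 0 0 c 0]) /\
  (forall a1 : F, a1 <> 1 ->
     Der (A8_2 a1) = [set D | exists d : F, D = mx22 0 0 0 d]) /\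
  (Der (A8_2 (1 : F)) = [set D | exists c d : F, D = mx22 0 0 c d]) /\
  (Der (A9_2 F) = [set D | exists c : F, D = mx22 0 0 c 0]) /\
  (Der (A10_2 F) = [set D | exists a c : F, D = mx22 a 0 c 0]) /\
  (Der (A11_2 F) = [set 0]) /\
  (Der (A12_2 F) = [set D | exists a c : F, D = mx22 a 0 c 0]).
Proof.
split=> [a1 a2 a4 b1|].
  apply: eq_set_mx22 => a b c d /=.
  by rewrite (Der_A1P char2) zero_mx22P.
split=> [a1 b1 b2 b1_neq0|].
  apply: eq_set_mx22 => a b c d /=.
  rewrite (Der_A2P char2) zero_mx22P.
  by split=> -[-> -> ->] => [/(mulf_eq0_neq b1_neq0) | ->]; rewrite ?mulr0.
split=> [a1 b2|].
  apply: eq_set_mx22 => a b c d /=.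
  by rewrite (Der_A2P char2) mul0r d_mx22P; split=> -[].
split=> [a1 b2 b2_neq1|].
  apply: eq_set_mx22 => a b c d /=; rewrite (Der_A3P char2) zero_mx22P.
  split=> -[-> -> ->] => [/(mulf_add1_eq0 char2 b2_neq1) | ->];
    by rewrite ?mul0r.
split=> [a1|].
  apply: eq_set_mx22 => a b c d /=.
  by rewrite (Der_A3P char2) (addrr_pchar2 char2) mulr0 c_mx22P; split=> -[].
split=> [a1 b2 b2_neq1|].
  apply: eq_set_mx22 => a b c d /=; rewrite (Der_A4P char2) d_mx22P.
  by split=> -[-> ->] => [/(mulf_add1_eq0 char2 b2_neq1) | ->]; rewrite ?mul0r.
split=> [a1|].
  apply: eq_set_mx22 => a b c d /=.
  by rewrite (Der_A4P char2) addNr mulr0 cd_mx22P; split=> -[].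
split=> [a1|].
  by apply: eq_set_mx22 => a b c d /=; rewrite (Der_A5P char2) c_mx22P.
split=> [a1 b1 b1_neq0|].
  apply: eq_set_mx22 => a b c d /=; rewrite (Der_A6P char2) zero_mx22P.
  by split=> -[-> -> ->] => [/(mulf_eq0_neq b1_neq0) | ->]; rewrite ?mulr0.
split=> [a1|].
  apply: eq_set_mx22 => a b c d /=.
  by rewrite (Der_A6P char2) mul0r d_mx22P; split=> -[].
split=> [a1 a1_neq1|].
  apply: eq_set_mx22 => a b c d /=; rewrite (Der_A7P char2) zero_mx22P.
  split=> -[-> -> ->] => [/(mulf_add1_eq0 char2 a1_neq1) | ->];
    by rewrite ?mul0r.
split.
  apply: eq_set_mx22 => a b c d /=.
  by rewrite (Der_A7P char2) (addrr_pchar2 char2) mulr0 c_mx22P; split=> -[].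
split=> [a1 a1_neq1|].
  apply: eq_set_mx22 => a b c d /=; rewrite (Der_A8P char2) d_mx22P.
  by split=> -[-> ->] => [/(mulf_add1_eq0 char2 a1_neq1) | ->]; rewrite ?mul0r.
split.
  apply: eq_set_mx22 => a b c d /=.
  by rewrite (Der_A8P char2) (addrr_pchar2 char2) mulr0 cd_mx22P; split=> -[].
split.
  by apply: eq_set_mx22 => a b c d /=; rewrite (Der_A9P char2) c_mx22P.
split.
  by apply: eq_set_mx22 => a b c d /=; rewrite (Der_A10P char2) ac_mx22P.
split.
  by apply: eq_set_mx22 => a b c d /=; rewrite (Der_A11P char2) zero_mx22P.
by apply: eq_set_mx22 => a b c d /=; rewrite (Der_A12P char2) ac_mx22P.
Qed.
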